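(* Let $C=(C_\bullet,d,t)$ be a quasi-precyclic $k$-module. Then the para-$S$-module $C^{\natural\natural}=(C^{\natural\natural}_\bullet,\partial+\delta,u^{-2},T)$ is a quasi-$S$-module.
   Context: $k$ is a unital ring, not assumed commutative; $k$-modules are left modules. A para-$S$-module $(C_\bullet,d,S,T)$ consists of $k$-modules $C_m$ ($m\ge 0$), $k$-linear maps $d:C_\bullet\to C_{\bullet-1}$, $S:C_\bullet\to C_{\bullet-2}$ and a $k$-linear isomorphism $T:C_\bullet\to C_\bullet$ such that $d^2=S(1-T)$ and $d,S,T$ commute pairwise. Then $\operatorname{ran}(1-T)$, with the induced operators, is a para-$S$-module. A para-$S$-module is $S$-contractible if there is a $k$-linear map $\beta$ of degree $+1$ commuting with $S$ and $T$ with $d\beta+\beta d=1$. A quasi-$S$-module is a para-$S$-module such that $\operatorname{ran}(1-T)$ is $S$-contractible and $C_\bullet=\ker(1-T)\oplus\operatorname{ran}(1-T)$. A para-precyclic $k$-module consists of $k$-modules $C_m$, $m\ge0$, face maps $d_j:C_m\to C_{m-1}$ ($0\le j\le m$) with $d_id_j=d_{j-1}d_i$ for $i<j$, and an invertible $k$-linear map $t:C_\bullet\to C_\bullet$ of degree $0$ with $td_i=d_{i+1}t$ for $0\le i\le m-1$ and $d_m=d_0t$ on $C_m$. The notation $(C_\bullet,d,t)$ uses $d=d_m$ on $C_m$. Put $T=t^{m+1}$ on $C_m$; it commutes with $d$ and $t$. It is quasi-precyclic if $C_\bullet=\ker(1-T)\oplus\operatorname{ran}(1-T)$. Let $b=\sum_{j=0}^m(-1)^jd_j$,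 $b'=\sum_{j=0}^{m-1}(-1)^jd_j$, $\tau=(-1)^mt$, $N=1+\tau+\cdots+\tau^m$ on $C_m$. Let $C^{\natural\natural}_m=\bigoplus_{p+q=m}C_qu^p$ ($p,q\ge0$), with $u$ a formal variable, $u^{-1}(xu^p)=xu^{p-1}$ for $p\ge1$, $u^{-1}(xu^0)=0$, and $T$ acting on coefficients. The maps $\partial,\delta:C^{\natural\natural}_\bullet\to C^{\natural\natural}_{\bullet-1}$ are $\partial(xu^{2p+1})=(1-\tau)xu^{2p}$, $\partial(xu^{2p})=Nxu^{2p-1}$ for $p\ge1$, $\partial(xu^0)=0$, and $\delta(xu^{2p})=bxu^{2p}$, $\delta(xu^{2p+1})=-b'xu^{2p+1}$. Then $(C^{\natural\natural}_\bullet,\partial+\delta,u^{-2},T)$ is a para-$S$-module. *)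

(* Defs.v *)
From HB Require Import structures.
From mathcomp Require Import all_boot all_algebra.
From mathcomp Require Import boolp.

Set Implicit Arguments.
Unset Strict Implicit.
Unset Printing Implicit Defensive.

Import GRing.Theory.
Local Open Scope ring_scope.

Section Range.
Variables (k : pzRingType) (V W : lmodType k).

Definition range_pred (f : {linear V -> W}) : {pred W} :=
  fun y => `[< exists x, f x = y >].

Lemma range_predP (f : {linear V -> W}) y :
  reflect (exists x, f x = y) (y \in range_pred f).
Proof. exact: asboolP. Qed.

Lemma range_pred_submod_closed f : submod_closed (range_pred f).
Proof.
split=> [|a _ _ /range_predP[x <-] /range_predP[y <-]].
  by apply/range_predP; exists 0; rewrite linear0.
by apply/range_predP; exists (a *: x + y); rewrite linearP.
Qed.

HB.instance Definition _ f :=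
  GRing.isSubmodClosed.Build k W (range_pred f) (range_pred_submod_closed f).

Record range_of (f : {linear V -> W}) :=
  RangeOf { range_val : W; range_valP : range_val \in range_pred f }.

HB.instance Definition _ f := [isSub of range_of f for @range_val f].
HB.instance Definition _ f := [Choice of range_of f by <:].
HB.instance Definition _ f := [SubChoice_isSubLmodule of range_of f by <:].

End Range.

Section RangeMap.
Variables (k : pzRingType) (V V' W W' : lmodType k).
Variables (f : {linear V -> W}) (f' : {linear V' -> W'}).
Variables (g : {linear W -> W'}).
Hypothesis gP : forall y, y \in range_pred f -> g y \in range_pred f'.

Definition range_map (y : range_of f) : range_of f' :=
  RangeOf (gP (range_valP y)).

Lemma range_map_linear : linear range_map.
Proof. by move=> a x y; apply: val_inj; rewrite /= !linearP. Qed.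

HB.instance Definition _ :=
  GRing.isLinear.Build k (range_of f) (range_of f') _ range_map range_map_linear.
End RangeMap.

Section Total.
Variables (k : pzRingType) (C : nat -> lmodType k) (m : nat).
(* C_0 (+) ... (+) C_m *)
Definition totalMod := {dffun forall q : 'I_m.+1, C q}.
HB.instance Definition _ := Choice.on totalMod.
Implicit Types x y z : totalMod.

Definition total_zero : totalMod := [ffun q : 'I_m.+1 => (0 : C q)].
Definition total_opp x : totalMod := [ffun q : 'I_m.+1 => (- x q : C q)].
Definition total_add x y : totalMod := [ffun q : 'I_m.+1 => (x q + y q : C q)].
Definition total_scale (a : k) x : totalMod := [ffun q : 'I_m.+1 => (a *: x q : C q)].

Fact total_addA : associative total_add.
Proof. by move=> x y z; apply/ffunP=> q; rewrite !ffunE addrA. Qed.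
Fact total_addC : commutative total_add.
Proof. by move=> x y; apply/ffunP=> q; rewrite !ffunE addrC. Qed.
Fact total_add0 : left_id total_zero total_add.
Proof. by move=> x; apply/ffunP=> q; rewrite !ffunE add0r. Qed.
Fact total_addN : left_inverse total_zero total_opp total_add.
Proof. by move=> x; apply/ffunP=> q; rewrite !ffunE addNr. Qed.
HB.instance Definition _ := GRing.isZmodule.Build totalMod
  total_addA total_addC total_add0 total_addN.

Fact total_scaleA a b x : total_scale a (total_scale b x) = total_scale (a * b) x.
Proof. by apply/ffunP=> q; rewrite !ffunE scalerA. Qed.
Fact total_scale1 : left_id 1 total_scale.
Proof. by move=> x; apply/ffunP=> q; rewrite !ffunE scale1r. Qed.
Fact total_scaleDr : right_distributive total_scale +%R.
Proof. by move=> a x y; apply/ffunP=> q; rewrite !ffunE scalerDr. Qed.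
Fact total_scaleDl x : {morph total_scale^~ x : a b / a + b}.
Proof. by move=> a b; apply/ffunP=> q; rewrite !ffunE scalerDl. Qed.
HB.instance Definition _ := GRing.Zmodule_isLmodule.Build k totalMod
  total_scaleA total_scale1 total_scaleDr total_scaleDl.
End Total.

(* Every graded module is concentrated in degrees m >= 0 and is zero in negative
   degrees.  Identities between maps with values in a negative degree are
   vacuous and do not appear below. *)

Record paraSModule (k : pzRingType) := ParaSModule {
  psMod :> nat -> lmodType k;
  psD : forall m, {linear psMod m.+1 -> psMod m};
  psS : forall m, {linear psMod m.+2 -> psMod m};
  psT : forall m, {linear psMod m -> psMod m};
  psT_bij : forall m, bijective (psT m);
  psDD : forall m (x : psMod m.+2),
    psD m (psD m.+1 x) = psS m (x - psT m.+2 x);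
  psDS : forall m (x : psMod m.+3),
    psD m (psS m.+1 x) = psS m (psD m.+2 x);
  psDT : forall m (x : psMod m.+1), psD m (psT m.+1 x) = psT m (psD m x);
  psST : forall m (x : psMod m.+2), psS m (psT m.+2 x) = psT m (psS m x)
}.

Section ParaSTheory.
Variables (k : pzRingType) (C : paraSModule k).

Definition Scontractible : Prop :=
  exists beta : forall m, {linear C m -> C m.+1},
  [/\ forall m (x : C m), beta m (psT C m x) = psT C m.+1 (beta m x),
      forall m (x : C m.+2), psS C m.+1 (beta m.+2 x) = beta m (psS C m x),
      (* S beta = beta S on C_1, where S vanishes *)
      forall x : C 1, psS C 0 (beta 1 x) = 0,
      (* d beta + beta d = 1, where d vanishes on C_0 *)
      forall x : C 0, psD C 0 (beta 0 x) = x
    & forall m (x : C m.+1),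
        psD C m.+1 (beta m.+1 x) + beta m (psD C m x) = x].

Lemma range_psD m y : y \in range_pred (idfun \- psT C m.+1) ->
  psD C m y \in range_pred (idfun \- psT C m).
Proof.
move=> /range_predP[x <-]; apply/range_predP; exists (psD C m x) => /=.
by rewrite linearB psDT.
Qed.

Lemma range_psS m y : y \in range_pred (idfun \- psT C m.+2) ->
  psS C m y \in range_pred (idfun \- psT C m).
Proof.
move=> /range_predP[x <-]; apply/range_predP; exists (psS C m x) => /=.
by rewrite linearB psST.
Qed.

Lemma range_psT m y : y \in range_pred (idfun \- psT C m) ->
  psT C m y \in range_pred (idfun \- psT C m).
Proof.
move=> /range_predP[x <-]; apply/range_predP; exists (psT C m x) => /=.
by rewrite linearB.
Qed.

Lemma range_psT_bij m : bijective (range_map (@range_psT m)).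
Proof.
have [g gT Tg] := psT_bij C m.
have gP y : y \in range_pred (idfun \- psT C m) ->
    g y \in range_pred (idfun \- psT C m).
  move=> /range_predP[x <-]; apply/range_predP; exists (g x) => /=.
  by apply: (can_inj gT); rewrite Tg linearB /= !Tg.
exists (fun y => RangeOf (gP _ (range_valP y))) => y; apply: val_inj => /=.
  exact: gT.
exact: Tg.
Qed.

(* ran(1 - T) with the operators induced by d, S, T *)
Program Definition ran_paraS : paraSModule k :=
  @ParaSModule k (fun m => range_of (idfun \- psT C m))
    (fun m => range_map (@range_psD m)) (fun m => range_map (@range_psS m))
    (fun m => range_map (@range_psT m)) range_psT_bij _ _ _ _.
Next Obligation. by apply: val_inj; apply: psDD. Qed.
Next Obligation. by apply: val_inj; apply: psDS. Qed.
Next Obligation. by apply: val_inj; apply: psDT. Qed.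
Next Obligation. by apply: val_inj; apply: psST. Qed.

End ParaSTheory.

(* V = ker(1 - T) (+) ran(1 - T) *)
Definition ker_ran_direct (k : pzRingType) (V : lmodType k)
    (T : {linear V -> V}) : Prop :=
  (forall x : V, exists y z : V,
     [/\ y - T y = 0, z \in range_pred (idfun \- T) & x = y + z]) /\
  (forall x : V, x - T x = 0 -> x \in range_pred (idfun \- T) -> x = 0).

Definition quasiSModule (k : pzRingType) (C : paraSModule k) : Prop :=
  Scontractible (ran_paraS C) /\ (forall m, ker_ran_direct (psT C m)).

(* [pcFace j] is d_j : C_{m+1} -> C_m for 0 <= j <= m + 1.  The last face
   [pcFace ord_max] is the map d of the notation (C, d, t). *)
Record paraPrecyclic (k : pzRingType) := ParaPrecyclic {
  pcMod :> nat -> lmodType k;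
  pcFace : forall m, 'I_m.+2 -> {linear pcMod m.+1 -> pcMod m};
  pct : forall m, {linear pcMod m -> pcMod m};
  pct_bij : forall m, bijective (pct m);
  (* d_i d_(j+1) = d_j d_i for i <= j *)
  pcFaceFace : forall m (i j : 'I_m.+2), (i <= j)%N -> forall x : pcMod m.+2,
    pcFace i (pcFace (lift ord0 j) x) =
    pcFace j (pcFace (widen_ord (leqnSn _) i) x);
  (* t d_i = d_(i+1) t on C_{m+1}, for 0 <= i <= m *)
  pctFace : forall m (i : 'I_m.+1) (x : pcMod m.+1),
    pct m (pcFace (widen_ord (leqnSn _) i) x) =
    pcFace (lift ord0 i) (pct m.+1 x);
  pcFace_max : forall m (x : pcMod m.+1),
    pcFace ord_max x = pcFace ord0 (pct m.+1 x)
}.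

Arguments pcFace {k p m} _.

Section ParaPrecyclicTheory.
Variables (k : pzRingType) (C : paraPrecyclic k).

Definition pcT m (x : C m) : C m := iter m.+1 (pct C m) x.
Definition pcb m (x : C m.+1) : C m := \sum_(j < m.+2) (-1) ^+ j *: pcFace j x.
Definition pcb' m (x : C m.+1) : C m :=
  \sum_(j < m.+1) (-1) ^+ j *: pcFace (widen_ord (leqnSn _) j) x.
Definition pctau m (x : C m) : C m := (-1) ^+ m *: pct C m x.
Definition pcN m (x : C m) : C m := \sum_(j < m.+1) iter j (@pctau m) x.

Lemma sign_linear (V W : lmodType k) (f : {linear V -> W}) n :
  linear (fun x => (-1) ^+ n *: f x).
Proof.
move=> a x y; rewrite linearP scalerDr !scalerA.
by congr (_ *: _ + _); rewrite commr_sign.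
Qed.

Lemma iter_linear (V : lmodType k) (f : V -> V) n :
  linear f -> linear (iter n f).
Proof. by move=> fl a x y; elim: n => //= n ->; rewrite fl. Qed.

Lemma sum_linear (V W : lmodType k) n (F : 'I_n -> V -> W) :
  (forall i, linear (F i)) -> linear (fun x => \sum_i F i x).
Proof.
move=> Fl a x y; rewrite scaler_sumr -big_split.
by apply: eq_bigr => i _; rewrite Fl.
Qed.

Fact pcT_linear m : linear (@pcT m).
Proof. by apply: iter_linear => a x y; rewrite linearP. Qed.
Fact pcb_linear m : linear (@pcb m).
Proof. by apply: sum_linear => j; apply: sign_linear. Qed.
Fact pcb'_linear m : linear (@pcb' m).
Proof. by apply: sum_linear => j; apply: sign_linear. Qed.
Fact pctau_linear m : linear (@pctau m).
Proof. exact: sign_linear. Qed.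
Fact pcN_linear m : linear (@pcN m).
Proof. by apply: sum_linear => j; apply: iter_linear; apply: pctau_linear. Qed.

HB.instance Definition _ m :=
  GRing.isLinear.Build k (C m) (C m) _ (@pcT m) (@pcT_linear m).
HB.instance Definition _ m :=
  GRing.isLinear.Build k (C m.+1) (C m) _ (@pcb m) (@pcb_linear m).
HB.instance Definition _ m :=
  GRing.isLinear.Build k (C m.+1) (C m) _ (@pcb' m) (@pcb'_linear m).
HB.instance Definition _ m :=
  GRing.isLinear.Build k (C m) (C m) _ (@pctau m) (@pctau_linear m).
HB.instance Definition _ m :=
  GRing.isLinear.Build k (C m) (C m) _ (@pcN m) (@pcN_linear m).

Definition quasiPrecyclic : Prop := forall m, ker_ran_direct (@pcT m).

Lemma pcT_bij m : bijective (@pcT m).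
Proof.
rewrite /pcT; elim: m.+1 => [|n IHn] /=; first by exists id.
exact: (bij_comp (pct_bij C m) IHn).
Qed.

Lemma pcT_iter_tau m x : iter m.+1 (@pctau m) x = pcT x.
Proof.
have E n y : iter n (@pctau m) y = (-1) ^+ (m * n) *: iter n (pct C m) y.
  elim: n => [|n IHn]; first by rewrite muln0 scale1r.
  rewrite iterS IHn /pctau -[(-1) ^+ (m * n)]signr_odd.
  have -> z : pct C m ((-1) ^+ odd (m * n) *: z)
      = (-1) ^+ odd (m * n) *: pct C m z by rewrite linearZ.
  by rewrite signr_odd scalerA -exprD mulnS.
by rewrite E -signr_odd oddM oddS andbN scale1r.
Qed.

Lemma tauN m (x : C m) : pctau (pcN x) = pcN (pctau x).
Proof.
rewrite /pcN linear_sum; apply: eq_bigr => j _.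
by rewrite -iterS -iterSr.
Qed.

Lemma pcN1tau m (x : C m) : pcN (x - pctau x) = x - pcT x.
Proof.
rewrite linearB /= -pcT_iter_tau /pcN -sumrB.
under eq_bigr do rewrite -iterSr.
rewrite -(big_mkord predT (fun j =>
  iter j (@pctau m) x - iter j.+1 (@pctau m) x)).
rewrite (eq_bigr (fun j =>
  (- iter j.+1 (@pctau m) x) - (- iter j (@pctau m) x))) => [|j _].
  by rewrite telescope_sumr // opprK addrC.
by rewrite opprK addrC.
Qed.

Lemma pc1tauN m (x : C m) : pcN x - pctau (pcN x) = x - pcT x.
Proof. by rewrite tauN -pcN1tau [RHS]linearB. Qed.

(* nat-indexed signed faces, and their initial sums *)
Let face m j (x : C m.+1) : C m := pcFace (inord j : 'I_m.+2) x.
Let D m j (x : C m.+1) : C m := (-1) ^+ j *: face j x.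
Let S m r (x : C m.+1) : C m := \sum_(j < r) D j x.

Let tface m j (x : C m.+1) : (j <= m)%N ->
  pct C m (face j x) = face j.+1 (pct C m.+1 x).
Proof.
move=> jm; have := pctFace (Ordinal (jm : (j < m.+1)%N)) x.
have -> : widen_ord (leqnSn _) (Ordinal (jm : (j < m.+1)%N)) = inord j.
  by apply: val_inj; rewrite /= inordK // ltnS leqW.
have -> // : lift ord0 (Ordinal (jm : (j < m.+1)%N)) = inord j.+1.
by apply: val_inj; rewrite /= inordK // !ltnS.
Qed.

Let face_last m (x : C m.+1) : face m.+1 x = face 0 (pct C m.+1 x).
Proof.
have := pcFace_max x.
have -> : ord_max = inord m.+1 :> 'I_m.+2 by apply: val_inj; rewrite /= inordK.
by have -> : ord0 = inord 0 :> 'I_m.+2 by apply: val_inj; rewrite /= inordK.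
Qed.

Let DS m j (x : C m.+1) : (j <= m)%N -> D j.+1 (pctau x) = pctau (D j x).
Proof.
move=> jm; rewrite /D /pctau /face.
have E (V W : lmodType k) (f : {linear V -> W}) n y :
    f ((-1) ^+ n *: y) = (-1) ^+ n *: f y by rewrite linearZ.
rewrite !E -/(face _ _) -tface // !scalerA -!exprD.
by rewrite addSnnS addnC !addSn !exprS mulrA mulrNN !mul1r.
Qed.

Let D0 m (x : C m.+1) : D 0 (pctau x) = D m.+1 x.
Proof. by rewrite /D /pctau scale1r face_last /face linearZ. Qed.

Let S_tau m r (x : C m.+1) : (r <= m.+1)%N ->
  S r.+1 (pctau x) = D m.+1 x + pctau (S r x).
Proof.
move=> rm; rewrite /S big_ord_recl D0 linear_sum; congr (_ + _).
by apply: eq_bigr => j _; apply: DS; apply: leq_trans (ltn_ord j) rm.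
Qed.

Let SS m r (x : C m.+1) : S r.+1 x = S r x + D r x.
Proof. by rewrite /S big_ord_recr. Qed.

Let bE m (x : C m.+1) : pcb x = S m.+2 x.
Proof. by apply: eq_bigr => j _; rewrite /D /face inord_val. Qed.

Let b'E m (x : C m.+1) : pcb' x = S m.+1 x.
Proof.
apply: eq_bigr => j _; rewrite /D /face; congr (_ *: pcFace _ _).
by apply: val_inj; rewrite /= inordK // ltnS ltnW.
Qed.

Lemma pcb1tau m (x : C m.+1) : pcb (x - pctau x) = pcb' x - pctau (pcb' x).
Proof.
by rewrite linearB /= !bE b'E S_tau // SS opprD addrA addrK.
Qed.

Lemma pcNb m (x : C m.+1) : pcN (pcb x) = pcb' (pcN x).
Proof.
pose tau i (y : C m) := iter i (@pctau m) y.
have tauD i y z : tau i (y + z) = tau i y + tau i z.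
  by rewrite /tau; elim: i => //= i ->; rewrite linearD.
have tauN' i y : tau i (- y) = - tau i y.
  by rewrite /tau; elim: i => //= i ->; rewrite linearN.
have A l y : (l <= m)%N -> S m.+1 (iter l.+1 (@pctau m.+1) y) =
    tau l (pcb y - S (m.+1 - l) y) + tau l.+1 (S (m - l) y).
  elim: l y => [|l IHl] y lm.
    have -> : pcb y - S (m.+1 - 0) y = D m.+1 y.
      by rewrite subn0 bE (SS m.+1) addrC addKr.
    by rewrite subn0 /= S_tau.
  have tS i z : tau i.+1 z = tau i (pctau z) by rewrite /tau iterSr.
  have ml : (m - l = (m - l.+1).+1)%N by rewrite subnSK.
  rewrite iterSr IHl 1?ltnW // !tS -!tauD; congr (tau _ _).
  rewrite (subSn (ltnW lm)) subSS ml.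
  have: (m - l.+1 <= m)%N by rewrite leq_subr.
  move: (m - l.+1)%N => r rm; have rm1 := leqW rm; rewrite !bE !S_tau //.
  rewrite (SS m.+1); move: (D m.+1 y) (S m.+1 y) (S r.+1 y) (S r y) => a u v w.
  have tD p q : pctau (p + q) = pctau p + pctau q by rewrite linearD.
  have tN p : pctau (- p) = - pctau p by rewrite linearN.
  rewrite !tD tN [a + pctau u]addrC addrKA.
  by rewrite addrA (addrAC (pctau u) (pctau a)).
pose G l := tau l (S (m.+1 - l) x).
have E (l : 'I_m.+1) : S m.+1 (iter l.+1 (@pctau m.+1) x) =
    tau l (pcb x) + (G l.+1 - G l).
  have lm : (l <= m)%N by rewrite -ltnS.
  by rewrite A // tauD tauN' /G subSS addrAC addrA.
have b'sum n (F : 'I_n -> C m.+1) : pcb' (\sum_i F i) = \sum_i pcb' (F i).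
  by rewrite linear_sum.
rewrite {2}/pcN big_ord_recl [pcb' (_ + _)]linearD /= b'sum b'E.
under eq_bigr => i _ do rewrite b'E [S _ _]E.
rewrite big_split /= addrCA -(big_mkord predT (fun l => G l.+1 - G l)).
have S0 : S 0 x = 0 by rewrite /S big_ord0.
rewrite telescope_sumr // /G subnn subn0 S0.
have -> : tau m.+1 0 = 0.
  by rewrite /tau; elim: (m.+1) => //= n ->; rewrite linear0.
by rewrite sub0r subrr addr0.
Qed.

Let face_simpl m i j (x : C m.+2) : (i <= j)%N -> (j <= m.+1)%N ->
  face i (face j.+1 x) = face j (face i x).
Proof.
move=> ij jm; have im := leq_trans ij jm.
have := pcFaceFace (i := inord i) (j := inord j) _ x.
rewrite !inordK ?ltnS // => /(_ ij).
have -> : lift ord0 (inord j : 'I_m.+2) = inord j.+1.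
  by apply: val_inj; rewrite /= !inordK ?ltnS.
have -> // : widen_ord (leqnSn _) (inord i : 'I_m.+2) = inord i.
by apply: val_inj; rewrite /= !inordK ?ltnS // leqW.
Qed.

Let DD m i j (x : C m.+2) : (i <= j)%N -> (j <= m.+1)%N ->
  D i (D j.+1 x) = - D j (D i x).
Proof.
have fZ p a n (y : C p.+1) : face a ((-1) ^+ n *: y) = (-1) ^+ n *: face a y.
  by rewrite /face linearZ.
move=> ij jm; rewrite /D !fZ face_simpl // !scalerA -!exprD.
by rewrite addnS exprS mulN1r scaleNr addnC.
Qed.

Let SS0 m r (x : C m.+2) : (r <= m.+2)%N -> S r (S r.+1 x) = 0.
Proof.
elim: r => [|r IHr] rm; first by rewrite {1}/S big_ord0.
have SD n (y z : C m.+1) : S n (y + z) = S n y + S n z.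
  by rewrite /S -big_split; apply: eq_bigr => i _; rewrite /D /face linearD scalerDr.
have DSum j n (y : C m.+2) : D j (S n y) = \sum_(i < n) D j (D i y).
  by rewrite /D /face linear_sum scaler_sumr.
rewrite (SS r.+1) SD (SS r (S _ x)) IHr 1?ltnW // add0r DSum /S -big_split.
apply: big1 => i _ /=; have ir : (i <= r)%N by rewrite -ltnS.
by rewrite (DD _ ir rm) addrN.
Qed.

Lemma pcbb m (x : C m.+2) : pcb (pcb x) = 0.
Proof. by rewrite !bE SS0. Qed.
Lemma pcb'b' m (x : C m.+2) : pcb' (pcb' x) = 0.
Proof. by rewrite !b'E SS0. Qed.

Lemma pcTtau m (x : C m) : pcT (pctau x) = pctau (pcT x).
Proof. by rewrite -!pcT_iter_tau -iterSr. Qed.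
Lemma pcTN m (x : C m) : pcT (pcN x) = pcN (pcT x).
Proof.
rewrite /pcN linear_sum; apply: eq_bigr => j _.
by rewrite /= -!pcT_iter_tau -!iterD addnC.
Qed.

Lemma pcTface m (j : 'I_m.+2) (x : C m.+1) :
  pcT (pcFace j x) = pcFace j (pcT x).
Proof.
have t0 (i : nat) (y : C m.+1) : (i <= m.+1)%N ->
    iter i (pct C m) (face 0 y) = face i (iter i (pct C m.+1) y).
  by elim: i => //= i IHi im; rewrite IHi 1?ltnW // tface.
have T0 (y : C m.+1) : pcT (face 0 y) = face 0 (pcT y).
  by rewrite /pcT t0 // face_last.
have [g gK Kg] : bijective (iter j (pct C m.+1)).
  elim: (j : nat) => [|n IHn] /=; first by exists id.
  exact: (bij_comp (pct_bij C m.+1) IHn).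
have jm : (j <= m.+1)%N by rewrite -ltnS.
have Tt p (y : C p) : pcT (iter j (pct C p) y) = iter j (pct C p) (pcT y).
  by rewrite /pcT -!iterD addnC.
have E (y : C m.+1) : pcFace j y = face j y by rewrite /face inord_val.
by rewrite !E -(Kg x) -(t0 _ _ jm) !Tt T0 (t0 _ _ jm).
Qed.

Lemma pcTb m (x : C m.+1) : pcT (pcb x) = pcb (pcT x).
Proof.
rewrite /pcb linear_sum; apply: eq_bigr => j _.
by rewrite linearZ /= pcTface.
Qed.
Lemma pcTb' m (x : C m.+1) : pcT (pcb' x) = pcb' (pcT x).
Proof.
rewrite /pcb' linear_sum; apply: eq_bigr => j _.
by rewrite linearZ /= pcTface.
Qed.

End ParaPrecyclicTheory.

Section NatNat.
Variables (k : pzRingType) (C : paraPrecyclic k).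

(* [totalMod C m] is (+)_(p + q = m) C_q u^p, an element x being the family of the
   coefficients x_q of u^(m - q) for 0 <= q <= m. *)
Definition nnT m (x : totalMod C m) : totalMod C m :=
  [ffun q : 'I_m.+1 => (pcT (x q) : C q)].

Definition nnUinv m (x : totalMod C m.+1) : totalMod C m :=
  [ffun q : 'I_m.+1 => (x (widen_ord (leqnSn _) q) : C q)].

Definition nnS m (x : totalMod C m.+2) : totalMod C m := nnUinv (nnUinv x).

(* The coefficient in C_q of the image comes from the summand C_q u^(m + 1 - q)
   under the first map, and from C_(q+1) u^(m - q) under the second one. *)
Definition nnPartial m (x : totalMod C m.+1) : totalMod C m :=
  [ffun q : 'I_m.+1 =>
    let y : C q := x (widen_ord (leqnSn _) q) in
    (if odd (m.+1 - q) then y - pctau y else pcN y : C q)].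

Definition nnDelta m (x : totalMod C m.+1) : totalMod C m :=
  [ffun q : 'I_m.+1 =>
    let y : C q.+1 := x (lift ord0 q) in
    (if odd (m - q) then - pcb' y else pcb y : C q)].

Definition nnD m (x : totalMod C m.+1) : totalMod C m := nnPartial x + nnDelta x.

Fact nnT_linear m : linear (@nnT m).
Proof. by move=> a x y; apply/ffunP=> q; rewrite !ffunE linearP. Qed.
Fact nnUinv_linear m : linear (@nnUinv m).
Proof. by move=> a x y; apply/ffunP=> q; rewrite !ffunE. Qed.
Fact nnS_linear m : linear (@nnS m).
Proof. by move=> a x y; rewrite /nnS (nnUinv_linear a x) nnUinv_linear. Qed.
Fact nnPartial_linear m : linear (@nnPartial m).
Proof.
move=> a x y; apply/ffunP=> q; rewrite !ffunE /=; case: ifP => _.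
  by rewrite linearP /= scalerBr opprD addrACA.
by rewrite linearP.
Qed.
Fact nnDelta_linear m : linear (@nnDelta m).
Proof.
move=> a x y; apply/ffunP=> q; rewrite !ffunE /=; case: ifP => _.
  by rewrite linearP /= opprD scalerN.
by rewrite linearP.
Qed.
Fact nnD_linear m : linear (@nnD m).
Proof.
move=> a x y.
by rewrite /nnD nnPartial_linear nnDelta_linear scalerDr addrACA.
Qed.

HB.instance Definition _ m := GRing.isLinear.Build k (totalMod C m) (totalMod C m) _
  (@nnT m) (@nnT_linear m).
HB.instance Definition _ m := GRing.isLinear.Build k (totalMod C m.+1) (totalMod C m) _
  (@nnUinv m) (@nnUinv_linear m).
HB.instance Definition _ m := GRing.isLinear.Build k (totalMod C m.+2) (totalMod C m) _
  (@nnS m) (@nnS_linear m).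
HB.instance Definition _ m := GRing.isLinear.Build k (totalMod C m.+1) (totalMod C m) _
  (@nnPartial m) (@nnPartial_linear m).
HB.instance Definition _ m := GRing.isLinear.Build k (totalMod C m.+1) (totalMod C m) _
  (@nnDelta m) (@nnDelta_linear m).
HB.instance Definition _ m := GRing.isLinear.Build k (totalMod C m.+1) (totalMod C m) _
  (@nnD m) (@nnD_linear m).

Lemma nnT_bij m : bijective (@nnT m).
Proof.
have ex q : exists g, cancel (@pcT k C q) g /\ cancel g (@pcT k C q).
  by have [g gK Kg] := pcT_bij C q; exists g.
have inv q := cid (ex q).
pose g q := sval (inv q).
exists (fun x : totalMod C m => [ffun q : 'I_m.+1 => (g q (x q) : C q)] : totalMod C m) => x;
  apply/ffunP=> q; rewrite !ffunE /g; case: (inv q) => h [hK Kh] /=.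
  exact: hK.
exact: Kh.
Qed.

Lemma totalMod_irr n (x : totalMod C n) i (h h' : (i < n.+1)%N) :
  x (Ordinal h) = x (Ordinal h') :> C i.
Proof. by rewrite (bool_irrelevance h h'). Qed.

Lemma nnDE m (x : totalMod C m.+1) q (hq : (q < m.+1)%N) (h0 : (q < m.+2)%N)
    (h1 : (q.+1 < m.+2)%N) : nnD x (Ordinal hq) =
  (if odd (m - q) then pcN (x (Ordinal h0)) - pcb' (x (Ordinal h1) : C q.+1)
   else x (Ordinal h0) - pctau (x (Ordinal h0)) + pcb (x (Ordinal h1) : C q.+1))
   :> C q.
Proof.
rewrite !ffunE /= subSn // oddS (totalMod_irr _ _ h0).
have -> : x (lift ord0 (Ordinal hq)) = x (Ordinal h1) :> C q.+1.
  exact: totalMod_irr.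
by case: odd.
Qed.

Lemma nnSE m (x : totalMod C m.+2) q (hq : (q < m.+1)%N) (h : (q < m.+3)%N) :
  nnS x (Ordinal hq) = x (Ordinal h) :> C q.
Proof. rewrite !ffunE; exact: totalMod_irr. Qed.

Lemma nnDD m (x : totalMod C m.+2) : nnD (nnD x) = nnS (x - nnT x).
Proof.
apply/ffunP=> -[q hq].
have h1 : (q < m.+2)%N by rewrite ltnW.
have h2 : (q < m.+3)%N by rewrite ltnW.
have h3 : (q.+2 < m.+3)%N by [].
rewrite (nnDE _ _ h1 hq) (nnSE _ _ h2) (nnDE _ h1 h2 h1) (nnDE (m := m.+1) (q := q.+1) _ hq h1 h3).
rewrite subSS subSn // oddS !ffunE.
move: (x (Ordinal h2) : C q) (x (Ordinal (h1 : (q.+1 < m.+3)%N)) : C q.+1)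
  (x (Ordinal h3) : C q.+2).
move=> a b c; case: odd => /=.
  rewrite [pcN (_ + _)]linearD [pcb' (_ - _)]linearB /= pcN1tau pcb'b' subr0.
  by rewrite pcNb addrK.
rewrite [pctau (_ - _)]linearB [pcb (_ + _)]linearD /= pcbb addr0 pcb1tau.
rewrite -pc1tauN opprB (addrC (pctau (pcb' b))) addrACA -addrA.
by rewrite addrK addrA addrNK.
Qed.

Lemma nnDT m (x : totalMod C m.+1) : nnD (nnT x) = nnT (nnD x).
Proof.
apply/ffunP=> q; rewrite !ffunE [in RHS]linearD /=; congr (_ + _); case: ifP => _ /=.
- by rewrite linearB /= pcTtau.
- by rewrite pcTN.
- by rewrite linearN /= pcTb'.
- by rewrite pcTb.
Qed.

Lemma nnST m (x : totalMod C m.+2) : nnS (nnT x) = nnT (nnS x).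
Proof. by apply/ffunP=> q; rewrite !ffunE. Qed.

Lemma nnDS m (x : totalMod C m.+3) : nnD (nnS x) = nnS (nnD x).
Proof.
apply/ffunP=> -[q hq].
have h1 : (q < m.+2)%N by rewrite ltnW.
have h2 : (q < m.+3)%N by rewrite ltnW.
have h3 : (q < m.+4)%N by rewrite ltnW.
have h4 : (q.+1 < m.+4)%N by [].
rewrite (nnSE _ _ h2) (nnDE _ _ h1 hq) (nnDE _ _ h3 h4).
rewrite (nnSE _ _ h3) (nnSE (q := q.+1) _ _ h4) 2?subSn ?oddS ?negbK // ltnW //.
Qed.

(* (C^nn, partial + delta, u^-2, T) *)
Definition natnat : paraSModule k :=
  @ParaSModule k (totalMod C) (@nnD) (@nnS) (@nnT)
    nnT_bij nnDD nnDS nnDT nnST.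

End NatNat.

(* Main.v *)
Require Import Defs.
From HB Require Import structures.
From mathcomp Require Import all_boot all_algebra.
From mathcomp Require Import boolp.

(** Write R for ran (1 - T) and suppose that C = ker (1 - T) (+) R in each
    degree.  Then 1 - T restricts to a bijection of R.  Since
    (1 - tau) N = N (1 - tau) = 1 - T, the operator 1 - tau is also invertible
    on R, with inverse s = N g, where g inverts 1 - T on R and vanishes on
    ker (1 - T) ([group_inv], [tau_inv]).

    The rows of C^nn alternate between 1 - tau and N, so on R they are
    contracted by
      beta (x u^2p) = s x u^(2p+1),    beta (x u^(2p+1)) = 0 :
    on even powers partial beta = 1 and beta partial = 0, on odd powers it is
    the other way round.  This beta commutes with u^-2 and T.  It needs no
    correction for the vertical part: delta beta + beta delta vanishes on odd
    powers because beta does, and on even powers it is s b - b' s, which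
    vanishes because b' N = N b ([pcNb]) and g commutes with b.  Hence beta
    contracts ran (1 - T) for the full boundary partial + delta
    ([row_htpyK]).

    The splitting into kernel and range holds on C^nn because T acts on each
    coefficient separately ([ker_ran_direct_nnT]). *)

Set Implicit Arguments.
Unset Strict Implicit.
Unset Printing Implicit Defensive.

Import GRing.Theory.
Local Open Scope ring_scope.

(** * The group inverse of an endomorphism *)

(** For e with V = ker e (+) ran e, this characterizes the value at x of the
    group inverse of e: the map inverting e on ran e and vanishing on ker e.
    It avoids choosing the two components of x. *)
Definition group_inv_rel (k : pzRingType) (V : lmodType k)
    (e : {linear V -> V}) (x w : V) : Prop :=
  w \in range_pred e /\ e (x - e w) = 0.

(** With R = ran (1 - T): the R-component of x is (1 - T) v for some v, and
    replacing v by its own R-component w does not change (1 - T) v, so 1 - T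
    maps R onto R. *)
Lemma group_inv_rel_exists (k : pzRingType) (V : lmodType k)
    (T : {linear V -> V}) :
  ker_ran_direct T -> forall x, exists w, group_inv_rel (idfun \- T) x w.
Proof.
move=> [dec _] x; have [y [_ [y0 /range_predP[v <-] ->]]] := dec x.
have [y' [w [y'0 wR Ev]]] := dec v.
exists w; split=> //.
have -> : y + (idfun \- T) v - (idfun \- T) w = y + (y' - T y').
  rewrite -addrA; congr (_ + _).
  by rewrite /= Ev linearD opprD addrACA addrK.
by rewrite y'0 addr0.
Qed.

Lemma group_inv_rel_unique (k : pzRingType) (V : lmodType k)
    (T : {linear V -> V}) :
  ker_ran_direct T -> forall x w w',
  group_inv_rel (idfun \- T) x w -> group_inv_rel (idfun \- T) x w' -> w = w'.
Proof.
move=> [_ ker0] x w w' [wR ew] [w'R ew'].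
set e : {linear V -> V} := idfun \- T in wR ew w'R ew' *.
have dR : w - w' \in range_pred e by rewrite rpredB.
(* e (w - w') lies in ran e, and in ker e by the two kernel conditions. *)
have ed0 : e (w - w') = 0.
  apply: ker0; last by apply/range_predP; exists (w - w').
  rewrite -[LHS]/(e (e (w - w'))).
  have -> : e (w - w') = (x - e w') - (x - e w).
    rewrite (linearB e); move: (e w) (e w') => a b.
    by rewrite opprB [RHS]addrC addrA addrNK.
  by rewrite (linearB e) ew ew' subr0.
by apply/eqP; rewrite -subr_eq0; apply/eqP/ker0.
Qed.

Definition group_inv (k : pzRingType) (V : lmodType k) (T : {linear V -> V})
    (H : ker_ran_direct T) (x : V) : V :=
  sval (cid (group_inv_rel_exists H x)).

Lemma group_invP (k : pzRingType) (V : lmodType k) (T : {linear V -> V})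
    (H : ker_ran_direct T) x : group_inv_rel (idfun \- T) x (group_inv H x).
Proof. exact: svalP (cid (group_inv_rel_exists H x)). Qed.

Lemma group_inv_eq (k : pzRingType) (V : lmodType k) (T : {linear V -> V})
    (H : ker_ran_direct T) x w :
  group_inv_rel (idfun \- T) x w -> group_inv H x = w.
Proof. exact/(group_inv_rel_unique H)/group_invP. Qed.

Lemma group_inv_linear (k : pzRingType) (V : lmodType k)
    (T : {linear V -> V}) (H : ker_ran_direct T) : linear (group_inv H).
Proof.
move=> a x y; apply: group_inv_eq.
have [xR ex] := group_invP H x; have [yR ey] := group_invP H y.
set e : {linear V -> V} := idfun \- T in xR ex yR ey *.
split; first by rewrite rpredD ?rpredZ.
rewrite (linearP e) opprD addrACA -scalerBr (linearP e).
by rewrite ex ey scaler0 addr0.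
Qed.

HB.instance Definition _ (k : pzRingType) (V : lmodType k)
    (T : {linear V -> V}) (H : ker_ran_direct T) :=
  GRing.isLinear.Build k V V _ (group_inv H) (group_inv_linear H).

Lemma group_invK (k : pzRingType) (V : lmodType k) (T : {linear V -> V})
    (H : ker_ran_direct T) x : x \in range_pred (idfun \- T) ->
  group_inv H x - T (group_inv H x) = x.
Proof.
move=> xR; have [wR ew] := group_invP H x.
apply/eqP; rewrite eq_sym -subr_eq0; apply/eqP.
apply: (proj2 H); first exact: ew.
by rewrite rpredB //; apply/range_predP; exists (group_inv H x).
Qed.

(** The relation [group_inv_rel] is preserved by any map intertwining the two
    operators, so the group inverse is natural. *)
Lemma group_inv_natural (k : pzRingType) (V V' : lmodType k)
    (T : {linear V -> V}) (T' : {linear V' -> V'}) (H : ker_ran_direct T)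
    (H' : ker_ran_direct T') (f : {linear V -> V'}) :
  (forall x, f (T x) = T' (f x)) ->
  forall x, f (group_inv H x) = group_inv H' (f x).
Proof.
move=> fT x; apply/esym/group_inv_eq; have [wR ew] := group_invP H x.
pose e : {linear V -> V} := idfun \- T.
pose e' : {linear V' -> V'} := idfun \- T'.
have fe z : f (e z) = e' (f z) by rewrite /= linearB fT.
split; first by case/range_predP: wR => v <-; apply/range_predP; exists (f v).
rewrite -[LHS]/(e' (f x - e' (f (group_inv H x)))).
by rewrite -fe -(linearB f) -fe [e _]ew linear0.
Qed.

(** * Inverting 1 - tau on ran (1 - T) *)

(** On ran (1 - T) this inverts 1 - tau because (1 - tau) N = 1 - T. *)
Definition tau_inv (k : pzRingType) (C : paraPrecyclic k)
    (H : quasiPrecyclic C) q (x : C q) : C q := pcN (group_inv (H q) x).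

Lemma tau_inv_linear (k : pzRingType) (C : paraPrecyclic k)
    (H : quasiPrecyclic C) q : linear (@tau_inv k C H q).
Proof. by move=> a x y; rewrite /tau_inv linearP /= linearP. Qed.

HB.instance Definition _ (k : pzRingType) (C : paraPrecyclic k)
    (H : quasiPrecyclic C) q :=
  GRing.isLinear.Build k (C q) (C q) _ (@tau_inv k C H q)
    (@tau_inv_linear k C H q).

Lemma tau_invT (k : pzRingType) (C : paraPrecyclic k) (H : quasiPrecyclic C)
    q (x : C q) : tau_inv H (pcT x) = pcT (tau_inv H x).
Proof.
rewrite /tau_inv pcTN.
by rewrite (@group_inv_natural _ _ _ _ _ (H q) (H q) (@pcT k C q)).
Qed.

Lemma tau_invb (k : pzRingType) (C : paraPrecyclic k) (H : quasiPrecyclic C)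
    q (x : C q.+1) : tau_inv H (pcb x) = pcb' (tau_inv H x).
Proof.
rewrite /tau_inv -pcNb.
rewrite (@group_inv_natural _ _ _ _ _ (H q.+1) (H q) (@pcb k C q)) // => z.
by rewrite /= pcTb.
Qed.

Lemma tau_invKr (k : pzRingType) (C : paraPrecyclic k) (H : quasiPrecyclic C)
    q (x : C q) : x \in range_pred (idfun \- @pcT k C q) ->
  tau_inv H x - pctau (tau_inv H x) = x.
Proof. by move=> xR; rewrite /tau_inv pc1tauN group_invK. Qed.

Lemma tau_invKl (k : pzRingType) (C : paraPrecyclic k) (H : quasiPrecyclic C)
    q (x : C q) : x \in range_pred (idfun \- @pcT k C q) ->
  tau_inv H (x - pctau x) = x.
Proof.
move=> xR; rewrite linearB /= -[RHS](tau_invKr H xR); congr (_ - _).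
rewrite /tau_inv tauN; congr (pcN _); apply/esym.
apply: (@group_inv_natural _ _ _ _ _ (H q) (H q) (@pctau k C q)) => z.
by rewrite /= pcTtau.
Qed.

(** * The contracting homotopy of the rows *)

(** Coefficients extended by zero beyond degree m: the top coefficient of the
    homotopy, in C_(m+1) u^0, has no counterpart in degree m. *)
Definition coef (k : pzRingType) (C : nat -> lmodType k) m
    (x : totalMod C m) (q : nat) : C q :=
  if @idP (q < m.+1)%N is ReflectT h then x (Ordinal h) else 0.

Lemma coefE (k : pzRingType) (C : nat -> lmodType k) m (x : totalMod C m) q
    (h : (q < m.+1)%N) : coef x q = x (Ordinal h).
Proof.
by rewrite /coef; case: {-}_ / idP => // h'; rewrite (bool_irrelevance h h').
Qed.

Lemma coef_linear (k : pzRingType) (C : nat -> lmodType k) m q :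
  linear (fun x : totalMod C m => coef x q).
Proof.
move=> a x y; rewrite /coef; case: {-}_ / idP => [h|_]; first by rewrite !ffunE.
by rewrite scaler0 addr0.
Qed.

(** The coefficient in C_q stands in front of u^(m+1-q), and the homotopy takes
    values in odd powers of u. *)
Definition row_htpy (k : pzRingType) (C : paraPrecyclic k)
    (H : quasiPrecyclic C) m (x : totalMod C m) : totalMod C m.+1 :=
  [ffun q : 'I_m.+2 =>
    (if odd (m.+1 - q) then tau_inv H (coef x q) else 0 : C q)].

Lemma row_htpyE (k : pzRingType) (C : paraPrecyclic k) (H : quasiPrecyclic C)
    m (x : totalMod C m) q (h : (q < m.+2)%N) :
  row_htpy H x (Ordinal h) =
  (if odd (m.+1 - q) then tau_inv H (coef x q) else 0) :> C q.
Proof. by rewrite ffunE. Qed.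

Lemma row_htpy_linear (k : pzRingType) (C : paraPrecyclic k)
    (H : quasiPrecyclic C) m : linear (@row_htpy k C H m).
Proof.
move=> a x y; apply/ffunP=> q; rewrite !ffunE.
case: ifP => _; first by rewrite coef_linear linearP.
by rewrite scaler0 addr0.
Qed.

HB.instance Definition _ (k : pzRingType) (C : paraPrecyclic k)
    (H : quasiPrecyclic C) m :=
  GRing.isLinear.Build k (totalMod C m) (totalMod C m.+1) _
    (@row_htpy k C H m) (@row_htpy_linear k C H m).

Lemma odd_subS_lt m q : odd (m.+1 - q) -> (q < m.+1)%N.
Proof. by rewrite -subn_gt0; case: subn. Qed.

Lemma row_htpyT (k : pzRingType) (C : paraPrecyclic k) (H : quasiPrecyclic C)
    m (x : totalMod C m) : row_htpy H (nnT x) = nnT (row_htpy H x).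
Proof.
apply/ffunP=> -[q hq]; rewrite row_htpyE [RHS]ffunE row_htpyE /=.
case: ifP => [/odd_subS_lt h|_]; last by rewrite linear0.
by rewrite !(coefE _ h) ffunE tau_invT.
Qed.

Lemma row_htpyS (k : pzRingType) (C : paraPrecyclic k) (H : quasiPrecyclic C)
    m (x : totalMod C m.+2) : nnS (row_htpy H x) = row_htpy H (nnS x).
Proof.
apply/ffunP=> -[q hq]; have h3 : (q < m.+4)%N by rewrite ltnW // ltnW.
rewrite (nnSE _ _ h3) !row_htpyE 2?subSn ?oddS ?negbK //; last exact: ltnW.
case: ifP => // /odd_subS_lt h.
have h2 : (q < m.+3)%N by rewrite ltnW // ltnW.
by rewrite (coefE _ h2) (coefE _ h) (nnSE _ _ h2).
Qed.

(** In degree one the homotopy lands in C_1 u, because its values carry odd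
    powers of u. *)
Lemma row_htpyS0 (k : pzRingType) (C : paraPrecyclic k) (H : quasiPrecyclic C)
    (x : totalMod C 1) : nnS (row_htpy H x) = 0.
Proof.
apply/ffunP=> -[[|//] hq].
by rewrite (nnSE _ _ (isT : 0 < 3)%N) row_htpyE ffunE.
Qed.

Lemma range_coef (k : pzRingType) (C : paraPrecyclic k) m (x : totalMod C m)
    q (h : (q < m.+1)%N) : x \in range_pred (idfun \- @nnT k C m) ->
  (x (Ordinal h) : C q) \in range_pred (idfun \- @pcT k C q).
Proof.
case/range_predP=> y <-; apply/range_predP; exists (y (Ordinal h)).
by rewrite !ffunE.
Qed.

Lemma row_htpyK0 (k : pzRingType) (C : paraPrecyclic k) (H : quasiPrecyclic C)
    (x : totalMod C 0) : x \in range_pred (idfun \- @nnT k C 0) ->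
  nnD (row_htpy H x) = x.
Proof.
move=> xR; apply/ffunP=> -[[|//] hq].
rewrite (nnDE _ _ (isT : 0 < 2)%N (isT : 1 < 2)%N) !row_htpyE /= linear0 addr0.
by rewrite (coefE _ hq) tau_invKr // range_coef.
Qed.

(** At an odd power of u the vertical terms b' s and s b cancel; at an even
    power only (1 - tau) s = 1 survives. *)
Lemma row_htpyK (k : pzRingType) (C : paraPrecyclic k) (H : quasiPrecyclic C)
    m (x : totalMod C m.+1) : x \in range_pred (idfun \- @nnT k C m.+1) ->
  nnD (row_htpy H x) + row_htpy H (nnD x) = x.
Proof.
move=> xR; apply/ffunP=> -[q hq]; rewrite ffunE.
have h2 : (q < m.+3)%N by rewrite ltnW.
rewrite (nnDE _ hq h2 (hq : q.+1 < m.+3)%N) !row_htpyE subSS.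
rewrite (subSn (hq : q <= m.+1)%N) oddS.
have [oddq|_] /= := boolP (odd (m.+1 - q)); last first.
  by rewrite linear0 !addr0 (coefE _ hq) tau_invKr // range_coef.
have h := odd_subS_lt oddq.
rewrite (coefE _ h) (nnDE _ h hq (h : q.+1 < m.+2)%N).
have /negbTE-> : ~~ odd (m - q) by rewrite -oddS -subSn.
rewrite (coefE _ (h : q.+1 < m.+2)%N) linear0 sub0r linearD /=.
by rewrite tau_invKl ?range_coef // tau_invb addrC addrK.
Qed.

(** * The quasi-S-module structure *)

Lemma range_row_htpy (k : pzRingType) (C : paraPrecyclic k)
    (H : quasiPrecyclic C) m (y : totalMod C m) :
  y \in range_pred (idfun \- psT (natnat C) m) ->
  row_htpy H y \in range_pred (idfun \- psT (natnat C) m.+1).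
Proof.
case/range_predP=> x <-; apply/range_predP; exists (row_htpy H x).
by rewrite /= linearB /= row_htpyT.
Qed.

Lemma Scontractible_ran_natnat (k : pzRingType) (C : paraPrecyclic k) :
  quasiPrecyclic C -> Scontractible (ran_paraS (natnat C)).
Proof.
move=> H; exists (fun m => range_map (@range_row_htpy k C H m)).
split=> [m x|m x|x|x|m x]; apply: val_inj => /=.
- exact: row_htpyT.
- exact: row_htpyS.
- exact: row_htpyS0.
- exact/row_htpyK0/range_valP.
- exact/row_htpyK/range_valP.
Qed.

(** T acts coefficientwise and the group inverse selects the component of each
    coefficient in ran (1 - T). *)
Lemma ker_ran_direct_nnT (k : pzRingType) (C : paraPrecyclic k) :
  quasiPrecyclic C -> forall m, ker_ran_direct (@nnT k C m).
Proof.
move=> H m; split=> [x|x x0 xR].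
  pose w : totalMod C m := [ffun q : 'I_m.+1 => (group_inv (H q) (x q) : C q)].
  exists (x - (w - nnT w)), (w - nnT w); split; last by rewrite subrK.
    apply/ffunP=> q; rewrite !ffunE.
    by have [_] := group_invP (H q) (x q).
  by apply/range_predP; exists w.
apply/ffunP=> -[q hq]; rewrite ffunE.
apply: (proj2 (H q)); last exact: range_coef.
by move/ffunP/(_ (Ordinal hq)): x0; rewrite !ffunE.
Qed.

Theorem proposition6p6 (k : pzRingType) (C : paraPrecyclic k) :
  quasiPrecyclic C -> quasiSModule (natnat C).
Proof.
move=> H; split; first exact: Scontractible_ran_natnat.
exact: ker_ran_direct_nnT.
Qed.
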